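(* Let $A\in\mathbb{R}^{p\times p}$ and let $B\in\mathbb{R}^{p\times p}$ be a square matrix of full rank, with columns $b_1,\dots,b_p$. Then there exists a single matrix $K\in\mathbb{R}^{p\times p}$ such that $A+BK$ is Schur stable and, for every $i\in\{1,\dots,p\}$, the pair $(A+BK,b_i)$ is controllable.
   Context: A real square matrix is Schur stable if all its eigenvalues have modulus strictly less than $1$. A pair $(M,b)$ with $M\in\mathbb{R}^{p\times p}$ and $b\in\mathbb{R}^{p}$ is controllable if the matrix $[b\ \ Mb\ \cdots\ M^{p-1}b]$ has rank $p$. *)

(* Defs.v *)
From mathcomp Require Import all_boot all_order all_algebra.
From mathcomp Require Import reals complex.

Set Implicit Arguments.
Unset Strict Implicit.
Unset Printing Implicit Defensive.

Import GRing.Theory Num.Theory.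
Local Open Scope ring_scope.
Local Open Scope complex_scope.

(* The spectrum of a real matrix is taken over the complex numbers R[i].
   The comparison is in R[i], where the norm is the (real) modulus. *)
Definition schur_stable (R : realType) (p : nat) (M : 'M[R]_p) : Prop :=
  forall z : R[i], eigenvalue (map_mx (real_complex R) M) z -> `|z| < 1.

Definition controllability_mx (R : realType) (p : nat)
    (M : 'M[R]_p) (b : 'cV[R]_p) : 'M[R]_p :=
  \matrix_(i < p, j < p) (M ^+ j *m b) i ord0.

Definition controllable (R : realType) (p : nat)
    (M : 'M[R]_p) (b : 'cV[R]_p) : Prop :=
  \rank (controllability_mx M b) = p.

(* Main.v *)
Require Import Defs.
From mathcomp Require Import all_boot all_order all_algebra all_fingroup.
From mathcomp Require Import reals complex.

(** Since [B] is invertible, [A + B *m K] ranges over all square matrices as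
    [K] varies, so only a Schur stable [M] for which every column of [B] is a
    cyclic vector has to be found.  Take the linear map that sends each column
    of [B] to one half of the next one, cyclically.  In the basis of these
    columns it is half of a permutation matrix, and permutation matrices
    preserve the sum of the moduli of the coordinates, so all eigenvalues have
    modulus 1/2 ([eigenvalue_scaled_perm]).  Starting from any column, the
    iterates run through nonzero multiples of all the columns, each visited
    once, so the controllability matrix is a column permutation of [B] times
    an invertible diagonal matrix ([controllable_scaled_cycle]). *)

Set Implicit Arguments.
Unset Strict Implicit.
Unset Printing Implicit Defensive.

Import GRing.Theory Num.Theory.
Local Open Scope ring_scope.

(** If [v] is a left eigenvector of [M], then permuting the entries of
    [w = v *m B] and multiplying them by [c] gives [z *: w].  Summing the
    moduli of the entries erases the permutation. *)
Lemma eigenvalue_scaled_perm (F : numFieldType) (n : nat) (M B : 'M[F]_n)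
    (s : 'S_n) (c z : F) :
  B \in unitmx -> M *m B = c *: col_perm s B -> eigenvalue M z ->
  `|z| = `|c|.
Proof.
move=> uB MB /eigenvalueP [v vM v0].
pose w := v *m B.
have w0 : w != 0.
  by apply: contraNneq v0 => wB0; rewrite -(mulmxK uB v) -/w wB0 mul0mx.
have wE j : z * w ord0 j = c * w ord0 (s j).
  have : z *: w = c *: col_perm s w.
    by rewrite scalemxAl -vM -mulmxA MB -scalemxAr !col_permE mulmxA.
  by move/matrixP/(_ ord0 j); rewrite [LHS]mxE [RHS]mxE [col_perm s w _ _]mxE.
have sum_neq0 : \sum_j `|w ord0 j| != 0.
  apply: contra w0 => /eqP sum0; apply/eqP/rowP => j; rewrite [RHS]mxE.
  apply: normr0_eq0.
  by apply: (psumr_eq0P (fun i _ => normr_ge0 (w ord0 i)) sum0).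
apply: (mulIf sum_neq0).
rewrite [in RHS](reindex_inj (@perm_inj _ s)) !mulr_sumr.
by apply: eq_bigr => j _; rewrite -!normrM wE.
Qed.

Lemma val_iter_ordS (n k : nat) (i : 'I_n) :
  iter k (@ordS n) i = ((i + k) %% n)%N :> nat.
Proof.
elim: k => [|k IHk] /=; first by rewrite addn0 modn_small.
by rewrite IHk -addn1 modnDml addn1 addnS.
Qed.

Lemma iter_ordS_inj (n : nat) (i : 'I_n) :
  injective (fun k : 'I_n => iter k (@ordS n) i).
Proof.
move=> j k /(congr1 val) /=; rewrite !val_iter_ordS => /eqP.
by rewrite eqn_modDl !modn_small // => /eqP/val_inj.
Qed.

Lemma pow_scaled_perm_col (R : comPzRingType) (n k : nat) (M B : 'M[R]_n)
    (s : 'S_n) (c : R) (i : 'I_n) :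
  M *m B = c *: col_perm s B ->
  M ^+ k *m col i B = c ^+ k *: col (iter k s i) B.
Proof.
move=> MB.
have Mcol j : M *m col j B = c *: col (s j) B.
  rewrite colE mulmxA MB -scalemxAl -colE; congr (c *: _).
  by apply/colP => l; rewrite !mxE.
elim: k => [|k IHk]; first by rewrite mul1mx scale1r.
by rewrite exprS -mulmxA IHk -scalemxAr Mcol scalerA -exprSr.
Qed.

(** The [j]-th Krylov vector is [c ^+ j] times the column of [B] reached from
    column [i] after [j] cyclic steps.  Since [ordS] is a single [n]-cycle, the
    first [n] steps meet every column once, and the controllability matrix
    inherits invertibility from [B]. *)
Lemma controllable_scaled_cycle (R : realType) (n : nat) (M B : 'M[R]_n)
    (c : R) (i : 'I_n) :
  B \in unitmx -> c != 0 -> M *m B = c *: col_perm (perm (@ordS_inj n)) B ->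
  controllable M (col i B).
Proof.
move=> uB c0 MB; apply: mxrank_unit.
pose u := perm (@iter_ordS_inj n i).
have -> : controllability_mx M (col i B) =
    col_perm u B *m diag_mx (\row_j c ^+ j).
  apply/matrixP => k j.
  rewrite mul_mx_diag mxE (pow_scaled_perm_col _ _ MB).
  rewrite !mxE mulrC permE.
  by congr (B k _ * _); apply: eq_iter => l; rewrite permE.
rewrite unitmx_mul col_permE unitmx_mul uB unitmx_perm unitmxE det_diag.
by rewrite unitfE; apply/prodf_neq0 => j _; rewrite mxE expf_neq0.
Qed.

Theorem proposition2 (R : realType) (p : nat) (A B : 'M[R]_p)
    (hB : \rank B = p) :
  exists K : 'M[R]_p,
    schur_stable (A + B *m K) /\
    forall i : 'I_p, controllable (A + B *m K) (col i B).
Proof.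
have uB : B \in unitmx by rewrite -row_free_unit /row_free hB.
pose s := perm (@ordS_inj p).
pose M := (2^-1 *: col_perm s B) *m invmx B.
have MB : M *m B = 2^-1 *: col_perm s B by rewrite mulmxKV.
exists (invmx B *m (M - A)); rewrite mulKVmx // addrC subrK; split; last first.
  by move=> i; apply: (controllable_scaled_cycle _ uB _ MB);
     rewrite invr_eq0 pnatr_eq0.
move=> z zM.
have MBC : map_mx (real_complex R) M *m map_mx (real_complex R) B =
    2^-1 *: col_perm s (map_mx (real_complex R) B).
  by rewrite -map_mxM MB map_mxZ map_col_perm fmorphV rmorph_nat.
have uBC : map_mx (real_complex R) B \in unitmx by rewrite map_unitmx.
rewrite (eigenvalue_scaled_perm uBC MBC zM).
by rewrite normfV normr_nat invf_lt1 ?ltr0n ?ltr1n.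
Qed.
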